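(* Let $f\in\mathcal F_{L,w}$, $y\in\mathbb R^n$, $\boldsymbol\varepsilon\in[0,\infty)^n$, and a multi-index $\alpha\in\mathbb N_0^n$ with $|\alpha|\ge2$ be given. Then Algorithm 2 (given in the context) returns a number $\mathrm{ALG}_{|\alpha|}(\alpha,f,y,\boldsymbol\varepsilon)$ satisfying $$|\partial^\alpha f(x)-\partial^\alpha f(y)|\le\mathrm{ALG}_{|\alpha|}(\alpha,f,y,\boldsymbol\varepsilon)\qquad\text{for all }x\in\mathcal B_{\boldsymbol\varepsilon}(y).$$
   Context: $\mathcal F_{L,w}$ denotes the scalar neural networks $f:\mathbb R^n\to\mathbb R$ with $L\ge 1$ hidden layers of width $w$ and activation $\mu=\tanh$ (applied componentwise): $$z^1(x)=W^1x+b^1,\quad a^1=\mu(z^1),\quad z^k=W^ka^{k-1}+b^k,\quad a^k=\mu(z^k)\ (k=2,\dots,L),\quad f=W^{L+1}a^L+b^{L+1},$$ with $W^1\in\mathbb R^{w\times n}$, $W^k\in\mathbb R^{w\times w}$ ($2\le k\le L$), $W^{L+1}\in\mathbb R^{1\times w}$ and biases of matching dimension. Write $z^{L+1}=f$, and for nonzero multi-indices $\gamma$, $p_\gamma^k=\partial^\gamma z^k$ and $h_\gamma^k=\partial^\gamma a^k$. $\mathcal B_{\boldsymbol\varepsilon}(y)=\{x\in\mathbb R^n:|x_j-y_j|\le\varepsilon_j,\ j=1,\dots,n\}$. $\mu^{(j)}$ is the $j$-th derivative of $\mu$, applied componentwise. $\odot$ is the Hadamard product, and for $v\in\mathbb R^w$,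 $M\in\mathbb R^{w\times n}$, $v\odot M$ is the Hadamard product of $v$ with every column of $M$. Absolute values and inequalities of vectors and matrices are componentwise. $e_\ell$ is the $\ell$-th coordinate multi-index. For each $m\ge1$ a number $N_m\in\mathbb N_0$ is fixed, and for $\rho\in\mathbb R^w$ $$Q^{m,k}(\rho)=\sum_{r=1}^{N_m}\frac{\rho^r}{r!}\odot|\mu^{(m+r)}(z^k(y))|+\rho^{N_m+1}\odot\frac{(m+N_m+1)!}{(N_m+1)!}\,2^{m+N_m+2}\exp\{-2\max(0,|z^k(y)|-\rho)\}$$ (componentwise powers, max, exp). Algorithm 1. Input: $f,y,\boldsymbol\varepsilon$ and $q\in\mathbb N$. Set $p_0^1=W^1$, $P^1=0\in\mathbb R^{w\times n}$. For $k=1,\dots,L$: $\widehat p^k=|p_0^k|+P^k$; $\rho^k=\widehat p^k\boldsymbol\varepsilon$; $Q^{m,k}=Q^{m,k}(\rho^k)$ for $m=1,\dots,q$; $M_1^k=|\mu'(z^k(y))|+Q^{1,k}$; $B^k=M_1^k\odot\widehat p^k-|\mu'(z^k(y))\odot p_0^k|$; $P^{k+1}=|W^{k+1}|B^k$; $p_0^{k+1}=W^{k+1}(\mu'(z^k(y))\odot p_0^k)$. Return $P^{L+1}$ and the vectors $Q^{m,k}$. For a multi-index $\alpha=e_{\ell_1}+\dots+e_{\ell_s}$, $s=|\alpha|$, let $\Pi_\alpha$ be the set of all partitions of $\{1,\dots,s\}$ into nonempty blocks, $\beta_I=\sum_{i\in I}e_{\ell_i}$ for nonempty $I\subseteq\{1,\dots,s\}$,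 and $\Gamma_\alpha=\{\beta_I:\pi\in\Pi_\alpha,\ I\in\pi\}$; $|\pi|$ is the number of blocks of $\pi$. Algorithm 2 (recursive in $s=|\alpha|\ge2$). Input: $f,y,\boldsymbol\varepsilon,\alpha$. (1) Compute $Q^{m,k}$, $m=1,\dots,s$, $k=1,\dots,L$, by Algorithm 1 with $q=s$. (2) For $\gamma\in\Gamma_\alpha\setminus\{\alpha\}$ and $k=1,\dots,L$ compute $P_\gamma^k$: if $\gamma=e_\ell$, $P_\gamma^k$ is the $\ell$-th column of the matrix $P^k$ of Algorithm 1; if $2\le|\gamma|<s$, $P_\gamma^k$ is the layer-$k$ quantity computed in step (3) of Algorithm 2 applied to $\gamma$. (3) Set $p_{\alpha,0}^1=0$ and $P_\alpha^1=0$. For $k=1,\dots,L$: set $\widehat p_\gamma^k=|p_\gamma^k(y)|+P_\gamma^k$ for $\gamma\in\Gamma_\alpha$ (with $p_{\alpha}^k(y)$ given by $p_{\alpha,0}^k$) and $M_m^k=|\mu^{(m)}(z^k(y))|+Q^{m,k}$ for $m=1,\dots,s$; set $$B_\alpha^k=\sum_{\pi\in\Pi_\alpha}\left(M_{|\pi|}^k\odot\bigodot_{I\in\pi}\widehat p_{\beta_I}^k-\left|\mu^{(|\pi|)}(z^k(y))\odot\bigodot_{I\in\pi}p_{\beta_I}^k(y)\right|\right);$$ set $p_{\alpha,0}^{k+1}=W^{k+1}h_\alpha^k(y)$, where $h_\alpha^k(y)$ is evaluated by $h_\alpha^k=\sum_{\pi\in\Pi_\alpha}\mu^{(|\pi|)}(z^k)\odot\bigodot_{I\in\pi}p_{\beta_I}^k$;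 set $P_\alpha^{k+1}=|W^{k+1}|B_\alpha^k$. (4) Return $\mathrm{ALG}_s(\alpha,f,y,\boldsymbol\varepsilon)=P_\alpha^{L+1}$. *)

(* Defs.v *)
From HB Require Import structures.
From mathcomp Require Import all_boot all_order all_algebra.
From mathcomp Require Import all_classical all_reals all_analysis.
Import Order.TTheory GRing.Theory Num.Theory.
Import numFieldNormedType.Exports.

Set Implicit Arguments.
Unset Strict Implicit.
Unset Printing Implicit Defensive.

Local Open Scope classical_set_scope.
Local Open Scope ring_scope.

Section MultiIndex.
Context {n : nat}.

Definition multiindex := {ffun 'I_n -> nat}.

Definition midx_deg (alpha : multiindex) : nat := (\sum_j alpha j)%N.

Definition midx_unit (l : 'I_n) : multiindex := [ffun j => nat_of_bool (j == l)].

(* The directions l_1 <= ... <= l_s with alpha = e_(l_1) + ... + e_(l_s), in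
   increasing order; the size of this sequence is [midx_deg alpha]. *)
Definition midx_dirs (alpha : multiindex) : seq 'I_n :=
  flatten [seq nseq (alpha l) l | l <- enum 'I_n].

(* subsets of {1, ..., s} *)
Definition midx_subset (alpha : multiindex) :=
  {set 'I_(size (midx_dirs alpha))}.

(* [beta_I] is the sum of the e_(l_i) for i in I. *)
Definition midx_block (alpha : multiindex) (I : midx_subset alpha) :
    multiindex :=
  [ffun j => (\sum_(i in I)
     midx_unit (tnth (in_tuple (midx_dirs alpha)) i) j)%N].

(* Partitions of {1, ..., s}; [finset.partition] requires nonempty blocks. *)
Definition midx_partition (alpha : multiindex) (pi : {set midx_subset alpha}) :
    bool :=
  finset.partition pi [set: 'I_(size (midx_dirs alpha))]%SET.

End MultiIndex.
Arguments multiindex : clear implicits.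

Section Defs.
Context {R : realType}.

Definition partial {n} (alpha : multiindex n) (g : 'cV[R]_n -> R) :
    'cV[R]_n -> R :=
  foldr (fun (l : 'I_n) (h : 'cV[R]_n -> R) (x : 'cV[R]_n) =>
           'D_(delta_mx l 0 : 'cV[R]_n) h x) g (midx_dirs alpha).

Definition partialv {n w} (alpha : multiindex n) (g : 'cV[R]_n -> 'cV[R]_w)
    (x : 'cV[R]_n) : 'cV[R]_w :=
  \col_i partial alpha (fun x' => g x' i 0) x.

Definition tanh (t : R) : R :=
  (expR t - expR (- t)) / (expR t + expR (- t)).

(* mu^(m), applied componentwise *)
Definition mud {w} (m : nat) (z : 'cV[R]_w) : 'cV[R]_w := map_mx (derive1n m tanh) z.

Definition absmx {m n} (A : 'M[R]_(m, n)) : 'M[R]_(m, n) :=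
  map_mx (fun t => `|t|) A.

Definition hadamard {m n} (A B : 'M[R]_(m, n)) : 'M[R]_(m, n) :=
  map2_mx *%R A B.

(* Hadamard product of a vector with every column of a matrix *)
Definition hadamard_cols {m n} (v : 'cV[R]_m) (A : 'M[R]_(m, n)) :
    'M[R]_(m, n) :=
  \matrix_(i, j) (v i 0 * A i j).

Definition in_box {n} (eps y x : 'cV[R]_n) : Prop :=
  forall j, `|x j 0 - y j 0| <= eps j 0.

(* Parameters of a network with hidden layers of width w.  Only the values
   [Whid f k], [bhid f k] for 2 <= k <= L are used by a network with L hidden
   layers; the last layer, numbered L + 1, is [Wout f], [bout f]. *)
Record network (n w : nat) := Network {
  Win : 'M[R]_(w, n);
  bin : 'cV[R]_w;
  Whid : nat -> 'M[R]_w;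
  bhid : nat -> 'cV[R]_w;
  Wout : 'rV[R]_w;
  bout : R }.

Section Algorithms.
Context {n w : nat} (f : network n w).

(* z^k; layers are numbered from 1, and index 0 is a dummy in all the
   layer-indexed definitions below. *)
Fixpoint preact (k : nat) (x : 'cV[R]_n) : 'cV[R]_w :=
  match k with
  | 0 => 0
  | k'.+1 => if k' is 0 then Win f *m x + bin f
             else Whid f k *m map_mx tanh (preact k' x) + bhid f k
  end.

Definition network_fun (L : nat) (x : 'cV[R]_n) : R :=
  (Wout f *m map_mx tanh (preact L x)) 0 0 + bout f.

Context (N : nat -> nat) (y eps : 'cV[R]_n).

Definition Qbound (m k : nat) (rho : 'cV[R]_w) : 'cV[R]_w :=
  \col_i (\sum_(1 <= r < (N m).+1)
             rho i 0 ^+ r / r`!%:R * `|mud (m + r) (preact k y) i 0|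
          + rho i 0 ^+ (N m).+1
            * ((m + N m + 1)`!%:R / ((N m + 1)`!)%:R * 2 ^+ (m + N m + 2)
               * expR (- 2 * Num.max 0 (`|preact k y i 0| - rho i 0)))).

Section Alg1Layer.
(* One pass of Algorithm 1 through layer k, from (p_0^k, P^k). *)
Context (k : nat) (pP : 'M[R]_(w, n) * 'M[R]_(w, n)).

Definition alg1_phat : 'M[R]_(w, n) := absmx pP.1 + pP.2.

Definition alg1_rho : 'cV[R]_w := alg1_phat *m eps.

Definition alg1_slope : 'M[R]_(w, n) :=
  hadamard_cols (mud 1 (preact k y)) pP.1.

Definition alg1_B : 'M[R]_(w, n) :=
  hadamard_cols (absmx (mud 1 (preact k y)) + Qbound 1 k alg1_rho) alg1_phat
  - absmx alg1_slope.

End Alg1Layer.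

(* (p_0^k, P^k) *)
Fixpoint alg1 (k : nat) : 'M[R]_(w, n) * 'M[R]_(w, n) :=
  match k with
  | 0 => (0, 0)
  | k'.+1 => if k' is 0 then (Win f, 0)
             else (Whid f k *m alg1_slope k' (alg1 k'),
                   absmx (Whid f k) *m alg1_B k' (alg1 k'))
  end.

(* Q^{m,k} *)
Definition alg1_Q (m k : nat) : 'cV[R]_w := Qbound m k (alg1_rho (alg1 k)).

(* M_m^k *)
Definition alg2_M (m k : nat) : 'cV[R]_w :=
  absmx (mud m (preact k y)) + alg1_Q m k.

Section Alg2Step.
(* Step (3) of Algorithm 2 for alpha; [Plow gamma k] is P_gamma^k for the
   gamma of order < |alpha|, as provided by step (2). *)
Context (Plow : multiindex n -> nat -> 'cV[R]_w) (alpha : multiindex n).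

Section Layer.
(* One pass through layer k, from (p_(alpha,0)^k, P_alpha^k). *)
Context (k : nat) (pP : 'cV[R]_w * 'cV[R]_w).

(* p_gamma^k(y) *)
Definition alg2_p (gamma : multiindex n) : 'cV[R]_w :=
  if gamma == alpha then pP.1 else partialv gamma (preact k) y.

Definition alg2_P (gamma : multiindex n) : 'cV[R]_w :=
  if gamma == alpha then pP.2 else Plow gamma k.

Definition alg2_phat (gamma : multiindex n) : 'cV[R]_w :=
  absmx (alg2_p gamma) + alg2_P gamma.

Definition hadamard_prod {s} (pi : {set {set 'I_s}})
    (g : {set 'I_s} -> 'cV[R]_w) : 'cV[R]_w :=
  \col_i \prod_(I in pi) g I i 0.

Definition alg2_term (pi : {set midx_subset alpha}) : 'cV[R]_w :=
  hadamard (mud #|pi| (preact k y))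
    (hadamard_prod pi (fun I => alg2_p (midx_block I))).

Definition alg2_h : 'cV[R]_w :=
  \sum_(pi : {set midx_subset alpha} | midx_partition pi) alg2_term pi.

Definition alg2_B : 'cV[R]_w :=
  \sum_(pi : {set midx_subset alpha} | midx_partition pi)
    (hadamard (alg2_M #|pi| k)
       (hadamard_prod pi (fun I => alg2_phat (midx_block I)))
     - absmx (alg2_term pi)).

End Layer.

(* (p_(alpha,0)^k, P_alpha^k) *)
Fixpoint alg2_step (k : nat) : 'cV[R]_w * 'cV[R]_w :=
  match k with
  | 0 => (0, 0)
  | k'.+1 => if k' is 0 then (0, 0)
             else (Whid f k *m alg2_h k' (alg2_step k'),
                   absmx (Whid f k) *m alg2_B k' (alg2_step k'))
  end.

End Alg2Step.

(* P_alpha^k for 1 <= |alpha| <= s, by recursion on the bound s on the order: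
   step (3) for alpha only calls the gamma of order < |alpha|, hence of order
   <= s.-1. *)
Fixpoint alg2_layer (s : nat) (alpha : multiindex n) (k : nat) : 'cV[R]_w :=
  if [pick l | alpha == midx_unit l] is Some l then col l (alg1 k).2
  else if s is s'.+1 then (alg2_step (alg2_layer s') alpha k).2
  else 0.

(* P_alpha^{L+1} *)
Definition ALG (L : nat) (alpha : multiindex n) : R :=
  let Plow := alg2_layer (midx_deg alpha).-1 in
  (absmx (Wout f) *m alg2_B Plow alpha L (alg2_step Plow alpha L)) 0 0.

End Algorithms.
End Defs.

Arguments network : clear implicits.

(* Main.v *)
Require Import Defs.
From HB Require Import structures.
From mathcomp Require Import all_boot all_order all_algebra.
From mathcomp Require Import all_classical all_reals all_analysis.
From mathcomp Require Import ring lra zify.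
Import Order.TTheory GRing.Theory Num.Theory.
Import numFieldNormedType.Exports.
Local Open Scope ring_scope.

(** The bound is a first-order perturbation estimate propagated through the
layers.  If every factor of a product moves from u to u' by at most U - |u|,
then the product of the u' differs from the product of the u by at most the
product of the U minus the absolute value of the product of the u
([dominatedM]).  So it suffices to write the derivatives of a layer as sums of
products, and to control the change of each factor over the box.

By the formula of Faa di Bruno ([faa_di_bruno]), a partial derivative of
tanh (z x) is a sum over the set partitions P of the directions of
differentiation; the term of P is the #|P|-th derivative of tanh at z x times
the derivatives of z along the blocks of P.

- The change of a derivative of z along a block is a quantity of lower order,
  or of the same order at the same layer; both are bounded by the recursion on
  orders and layers ([alg2_B_valid], [alg2_step_valid], [alg2_layer_valid]).
  An affine layer multiplies such bounds by the absolute values of its weights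
  ([affine_layer_dist]).

- The change of a derivative of tanh is bounded by a Taylor expansion at z y,
  with remainder estimated by the inequality
  |tanh^(j) t| <= j! 2^(j+1) exp(-2|t|), j >= 1 ([norm_derive1n_tanh_le],
  [derive1n_tanh_dist]).  It requires a radius for z x - z y over the box,
  which the mean value inequality provides once the first-order derivatives of
  z are bounded over the box ([box_mean_value]); these first-order bounds are
  the matrices computed by [alg1] ([alg1_valid_layer]).

Two choices keep all derivatives along coordinate axes.  The mean value
inequality changes one coordinate at a time, along a path from y to x inside the
box.  And iterated derivatives are taken in increasing order of the directions,
an order that the directions in a block of a partition inherit, so the
derivative along a block is literally the one of its multi-index
([midx_dirs_block]). *)

Lemma le_of_eq {R : realType} (x y : R) : x = y -> x <= y.
Proof. by move=> ->. Qed.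

(** * Derivatives of the hyperbolic tangent *)

Section Tanh.
Context {R : realType}.
Implicit Types t : R.

(** With u = exp(-2t), tanh t = 1 - 2u/(1+u), and every derivative of tanh is a
linear combination of the functions u^(i+1)/(1+u)^(j+1). *)
Definition sigterm (i j : nat) t : R :=
  expR (- 2 * t) ^+ i.+1 / (1 + expR (- 2 * t)) ^+ j.+1.

Lemma sigterm_den_gt0 t : 0 < 1 + expR (- 2 * t) :> R.
Proof. by rewrite addr_gt0 ?expR_gt0. Qed.

(** The two coefficients have absolute sum 2(j+1) when i <= j; this is the factor
gained in the bound of [norm_derive1n_tanh_le] at each differentiation. *)
Lemma is_derive_sigterm (i j : nat) t : (i <= j)%N ->
  is_derive t 1 (sigterm i j)
    (- 2 * i.+1%:R * sigterm i j.+1 t + 2 * (j - i)%:R * sigterm i.+1 j.+1 t).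
Proof.
move=> ij.
have du : is_derive t 1 (fun s : R => expR (- 2 * s)) (expR (- 2 * t) * - 2).
  have dl : is_derive t 1 (fun s : R => - 2 * s) (- 2).
    have -> : (fun s : R => - 2 * s) = (- 2 : R) *: (id : R -> R) by apply/funext.
    by apply: is_derive_eq; rewrite /GRing.scale /= mulr1.
  exact: (is_derive1_comp (f := expR)).
have den0 := lt0r_neq0 (sigterm_den_gt0 t).
set u := (fun s : R => expR (- 2 * s)) in du.
have -> : sigterm i j = u ^+ i.+1 * (fun s => ((1 + u s) ^+ j.+1)^-1).
  by apply/funext => s; rewrite /sigterm fctE exprfctE.
have dq : is_derive t 1 (fun s => ((1 + u s) ^+ j.+1)^-1)
   (- ((1 + u t) ^+ j.+1) ^- 2 *: (j.+1%:R * (1 + u t) ^+ j * (u t * -2))).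
  apply: (is_deriveV (f := fun s => (1 + u s) ^+ j.+1)).
    by rewrite expf_neq0.
  have -> : (fun s : R => (1 + u s) ^+ j.+1) = (cst 1 + u) ^+ j.+1.
    by apply/funext => s; rewrite exprfctE.
  by apply: is_derive_eq; rewrite add0r.
have nn : (j - i)%:R = j%:R - i%:R :> R by rewrite natrB.
apply: is_derive_eq.
rewrite /sigterm nn /GRing.scale /= -/(u t).
rewrite -[1 + expR _]/(1 + u t) in den0 *.
rewrite [LHS]/=.
set v := u t in den0 *.
rewrite -[j.+1%:R]natr1 -[i.+1%:R]natr1.
rewrite exprfctE -/v ?(exprS _ i.+1) (exprS _ i) !(exprS _ j.+1) !(exprS _ j).
have: (1 + v) ^+ j != 0 by rewrite expf_neq0.
move: ((1 + v) ^+ j) => q q0.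
by field; rewrite den0 q0.
Qed.

Lemma sigterm_ge0 i j t : 0 <= sigterm i j t.
Proof. by rewrite divr_ge0 ?exprn_ge0 ?expR_ge0 // ltW ?sigterm_den_gt0. Qed.

(** For t >= 0 one of the factors u is kept and the others are bounded by 1 + u.
For t < 0 the bound to reach is 1/u, and u^(i+2) <= (1+u)^(j+1) because
i + 2 <= j + 1. *)
Lemma sigterm_le i j t : (i < j)%N -> sigterm i j t <= expR (- 2 * `|t|).
Proof.
move=> ij; rewrite /sigterm.
have d0 := sigterm_den_gt0 t.
have u0 := expR_gt0 (- 2 * t).
have le1 : 1 <= 1 + expR (- 2 * t) by rewrite lerDl ltW.
have leu : expR (- 2 * t) <= 1 + expR (- 2 * t) by rewrite lerDr.
rewrite ler_pdivrMr ?exprn_gt0 //.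
set u := expR _ in u0 le1 leu d0 *.
have lepow k : u ^+ k <= (1 + u) ^+ k.
  by rewrite lerXn2r ?nnegrE // ltW.
have [t0|t0] := leP 0 t.
  rewrite ger0_norm // -/u exprS ler_pM2l //.
  apply: le_trans (lepow i) _.
  by rewrite ler_weXn2l // ltnW // ltnS ltnW.
have -> : expR (- 2 * `|t|) = u^-1.
  by rewrite ltr0_norm // /u -expRN; congr expR; ring.
rewrite mulrC ler_pdivlMr // -exprSr.
apply: le_trans (lepow i.+2) _.
by rewrite ler_weXn2l.
Qed.

Lemma tanhE : @tanh R = (fun t => 1 - 2 * sigterm 0 0 t).
Proof.
apply/funext => t; rewrite /tanh /sigterm !expr1.
have -> : - 2 * t = - t - t by lra.
rewrite expRD !expRN.
have := expR_gt0 t; set e := expR t => e0.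
have e1 : e != 0 by rewrite gt_eqF.
have e2 : e ^+ 2 + 1 != 0 by rewrite gt_eqF // ltr_wpDl ?sqr_ge0.
by field; rewrite e1 e2.
Qed.

Lemma derive1_tanh : derive1 (@tanh R) = (fun t => 4 * sigterm 0 1 t).
Proof.
apply/funext => t; rewrite derive1E tanhE.
have d := is_derive_sigterm 0 0 t (leqnn _).
have -> : (fun s : R => 1 - 2 * sigterm 0 0 s) = cst 1 - 2 *: sigterm 0 0.
  by apply/funext.
rewrite derive_val /= /GRing.scale /= subnn; lra.
Qed.

(** The Eulerian expansion of the derivatives of tanh.  It is represented by a list
of pairs (coefficient, exponent), so that differentiation is a map on lists
that multiplies the absolute sum of the coefficients by 2(m+2).  The expansion
starts at the first derivative because the strict inequality between the indices
of [sigterm], which [sigterm_le] requires, holds from there on. *)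
Lemma derive1n_tanh_sigterm m : exists2 s : seq (R * nat),
  derive1n m.+1 (@tanh R) = (fun t => \sum_(p <- s) p.1 * sigterm p.2 m.+1 t) &
  (forall p, p \in s -> (p.2 <= m)%N) /\
  \sum_(p <- s) `|p.1| <= m.+1`!%:R * 2 ^+ m.+2.
Proof.
elim: m => [|m [s Es [sm sC]]].
  exists [:: (4, 0%N)].
    by rewrite derive1n1 derive1_tanh; apply/funext => t; rewrite big_seq1.
  split; first by move=> p; rewrite inE => /eqP ->.
  by rewrite big_seq1 /= ger0_norm // mul1r expr2; lra.
pose f (p : R * nat) : R * nat := (p.1 * (- 2 * p.2.+1%:R), p.2).
pose g (p : R * nat) : R * nat := (p.1 * (2 * (m.+1 - p.2)%:R), p.2.+1).
exists (map f s ++ map g s).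
  rewrite derive1nS Es; apply/funext => t; rewrite derive1E.
  suff [_ ->] : is_derive t 1 (fun t => \sum_(p <- s) p.1 * sigterm p.2 m.+1 t)
    (\sum_(p <- s) ((f p).1 * sigterm (f p).2 m.+2 t
                    + (g p).1 * sigterm (g p).2 m.+2 t)).
    by rewrite big_split big_cat !big_map.
  elim: s sm {sC Es} => [|[c i] s IHs] sm.
    under eq_fun do rewrite big_nil.
    by rewrite big_nil; apply: is_derive_cst.
  have -> : (fun t => \sum_(p <- (c, i) :: s) p.1 * sigterm p.2 m.+1 t) =
     c *: sigterm i m.+1 + (fun t => \sum_(p <- s) p.1 * sigterm p.2 m.+1 t).
    by apply/funext => r; rewrite big_cons.
  have im : (i <= m.+1)%N by rewrite leqW // (sm (c, i)) ?mem_head.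
  have d := is_derive_sigterm i m.+1 t im.
  have {}IHs := IHs (fun p ps => sm p (mem_behead (s := _ :: _) ps)).
  apply: is_derive_eq; rewrite big_cons /= /GRing.scale /=; lra.
split.
  move=> p; rewrite mem_cat => /orP[] /mapP[q qs ->] /=; last by rewrite ltnS sm.
  by rewrite leqW ?sm.
rewrite big_cat /= !big_map -big_split /= factS natrM exprS.
apply: (@le_trans _ _ (2 * m.+2%:R * \sum_(p <- s) `|p.1|)); last first.
  rewrite [X in _ <= X](_ : _ = 2 * m.+2%:R * (m.+1`!%:R * 2 ^+ m.+2)); last by ring.
  by rewrite ler_wpM2l.
rewrite mulr_sumr; apply: le_of_eq.
apply: eq_big_seq => p /sm pm.
rewrite !normrM normrN !normr_nat natrB ?leqW //.
by rewrite -[m.+2%:R]natr1 -[m.+1%:R]natr1 -[p.2.+1%:R]natr1; ring.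
Qed.

Lemma is_derive_derive1n_tanh m t :
  is_derive t 1 (derive1n m (@tanh R)) (derive1n m.+1 tanh t).
Proof.
rewrite derive1nS derive1E; apply: derivableP.
case: m => [|m].
  rewrite derive1n0 tanhE.
  have d := is_derive_sigterm 0 0 t (leqnn _).
  have -> : (fun s : R => 1 - 2 * sigterm 0 0 s) = cst 1 - 2 *: sigterm 0 0.
    by apply/funext.
  exact: ex_derive.
have [s -> [sm _]] := derive1n_tanh_sigterm m.
elim: s sm => [|[c i] s IHs] sm.
  under eq_fun do rewrite big_nil.
  exact: derivable_cst.
have -> : (fun t => \sum_(p <- (c, i) :: s) p.1 * sigterm p.2 m.+1 t) =
   c *: sigterm i m.+1 + (fun t => \sum_(p <- s) p.1 * sigterm p.2 m.+1 t).
  by apply/funext => r; rewrite big_cons.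
have im : (i <= m.+1)%N by rewrite leqW // (sm (c, i)) ?mem_head.
have d := is_derive_sigterm i m.+1 t im.
apply: derivableD; last by apply: IHs => p ps; rewrite sm // inE ps orbT.
by apply: derivableZ; exact: ex_derive.
Qed.

Lemma norm_derive1n_tanh_le m t :
  `|derive1n m.+1 (@tanh R) t| <= m.+1`!%:R * 2 ^+ m.+2 * expR (- 2 * `|t|).
Proof.
have [s -> [sm sC]] := derive1n_tanh_sigterm m.
apply: le_trans (ler_norm_sum _ _ _) _.
apply: (@le_trans _ _ ((\sum_(p <- s) `|p.1|) * expR (- 2 * `|t|))); last first.
  by rewrite ler_wpM2r ?expR_ge0.
rewrite mulr_suml big_seq [X in _ <= X]big_seq ler_sum // => p /sm pm.
by rewrite normrM ler_wpM2l // ger0_norm ?sigterm_ge0 ?sigterm_le.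
Qed.

End Tanh.

(** * Taylor estimates *)

Section Taylor.
Context {R : realType}.

Lemma derive_ge0_le (F dF : R -> R) (T : R) :
  (forall s : R, is_derive s 1 F (dF s)) ->
  (forall s, 0 <= s <= T -> 0 <= dF s) ->
  forall s, 0 <= s <= T -> F 0 <= F s.
Proof.
move=> FD dF0 s /andP[s0 sT].
have [c] : exists2 c, c \in `[0, s]%R & F s - F 0 = dF c * (s - 0).
  apply: MVT_segment => //.
  apply: derivable_within_continuous => x _.
  exact: (@ex_derive _ _ _ _ _ _ _ (FD x)).
rewrite in_itv /= => /andP[c0 cs] E.
rewrite -subr_ge0 E subr0 mulr_ge0 // dF0 // c0 /=.
exact: le_trans cs sT.
Qed.

(** Lagrange's bound on the Taylor remainder, for a family G whose members are the
successive derivatives of its first one.  By induction on the order: the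
derivative of the remainder is the remainder of G 1, and a function that starts
at 0 is bounded by any primitive of a bound on its derivative. *)
Lemma taylor_remainder_le (G : nat -> R -> R) (k : nat) (C T : R) :
  (forall m (s : R), is_derive s 1 (G m) (G m.+1 s)) ->
  (forall s, 0 <= s <= T -> `|G k s| <= C) ->
  forall s, 0 <= s <= T ->
    `|G 0%N s - \sum_(r < k) s ^+ r / r`!%:R * G r 0| <= C * s ^+ k / k`!%:R.
Proof.
elim: k G => [|k IHk] G GD GC s sT.
  by rewrite big_ord0 subr0 expr0 fact0 mulr1 divr1 GC.
have {}IHk := IHk (fun m => G m.+1) (fun m => GD m.+1) GC.
(* p is the Taylor polynomial, q the claimed bound; q' bounds (G 0 - p)' *)
pose p := \poly_(r < k.+1) (G r 0 / r`!%:R).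
have pE t : p.[t] = \sum_(r < k.+1) t ^+ r / r`!%:R * G r 0.
  by rewrite horner_poly; apply: eq_bigr => r _; ring.
have p'E t : (p^`()).[t] = \sum_(r < k) t ^+ r / r`!%:R * G r.+1 0.
  have -> : (p^`())%R = \poly_(r < k) (G r.+1 0 / r`!%:R).
    apply/polyP => i; rewrite coef_deriv !coef_poly ltnS; case: ifP => // _.
      rewrite factS natrM -[LHS]mulr_natr.
      have : i`!%:R != 0 :> R by rewrite pnatr_eq0 -lt0n fact_gt0.
      have : i.+1%:R != 0 :> R by [].
      by move: (_.+1%:R) (_`!%:R) => a b a0 b0; field; rewrite a0 b0.
    by rewrite mul0rn.
  by rewrite horner_poly; apply: eq_bigr => r _; ring.
pose q := \poly_(r < k.+2) (if r == k.+1 then C / k.+1`!%:R else 0).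
have qE t : q.[t] = C * t ^+ k.+1 / k.+1`!%:R.
  rewrite horner_poly big_ord_recr /= eqxx big1 ?add0r; first by ring.
  by move=> i _; rewrite ltn_eqF ?mul0r.
have q'E t : (q^`()).[t] = C * t ^+ k / k`!%:R.
  have -> : (q^`())%R = (C / k`!%:R) *: 'X^k.
    apply/polyP => i; rewrite coef_deriv coefZ coefXn coef_poly ltnS eqSS.
    have [->|ik] := eqVneq i k; last by rewrite if_same mul0rn mulr0.
    rewrite leqnn mulr1 factS natrM -[LHS]mulr_natr.
    have : k`!%:R != 0 :> R by rewrite pnatr_eq0 -lt0n fact_gt0.
    have : k.+1%:R != 0 :> R by [].
    by move: (_.+1%:R) (_`!%:R) => a b a0 b0; field; rewrite a0 b0.
  by rewrite hornerZ hornerXn; ring.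
have p0 : p.[0] = G 0%N 0.
  rewrite pE big_ord_recl big1 ?addr0.
    by rewrite expr0 fact0 divr1 mul1r.
  by move=> i _; rewrite /= expr0n /= !mul0r.
have q0 : q.[0] = 0 by rewrite qE expr0n /= mulr0 mul0r.
rewrite -pE -qE ler_norml; apply/andP; split.
  have D (t : R) : is_derive t 1 (horner q + (G 0%N - horner p))
      (q^`().[t] + (G 1%N t - p^`().[t])).
    have := GD 0%N t => ?; exact: is_deriveD.
  have := derive_ge0_le _ _ T D _ s sT; rewrite !fctE q0 p0 subrr addr0.
  move=> H; rewrite -subr_ge0 opprK addrC; apply: H => t tT.
  have := IHk t tT; rewrite q'E p'E ler_norml => /andP[+ _].
  by rewrite -subr_ge0 opprK addrC.
have D (t : R) : is_derive t 1 (horner q - (G 0%N - horner p))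
    (q^`().[t] - (G 1%N t - p^`().[t])).
  have := GD 0%N t => ?; exact: is_deriveB.
have := derive_ge0_le _ _ T D _ s sT; rewrite !fctE q0 p0 subrr subr0.
move=> H; rewrite -subr_ge0; apply: H => t tT.
have := IHk t tT; rewrite q'E p'E ler_norml => /andP[_].
by rewrite -subr_ge0.
Qed.

Lemma is_derive_comp_affine (g : R -> R) (dg a c t : R) :
  is_derive (a + t * c) 1 g dg ->
  is_derive t 1 (fun s => g (a + s * c)) (c * dg).
Proof.
have lD : is_derive t 1 (fun s : R => a + s * c) c.
  have -> : (fun s : R => a + s * c) = cst a + c *: (id : R -> R).
    by apply/funext => s; rewrite !fctE /GRing.scale /= mulrC.
  have := is_deriveD (is_derive_cst a t 1) (is_deriveZ c (is_derive_id t (1 : R))).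
  by rewrite add0r /GRing.scale /= mulr1.
by move=> gD; rewrite mulrC; apply: (is_derive1_comp (f := g)).
Qed.

(** The right-hand side is an entry of [Qbound].  The remainder is evaluated on the
segment from z0 to z, where the absolute value is at least |z0| - rho, and
at least 0. *)
Lemma derive1n_tanh_dist (m N : nat) (z0 z rho : R) : `|z - z0| <= rho ->
  `|derive1n m.+1 tanh z - derive1n m.+1 tanh z0| <=
  \sum_(1 <= r < N.+1) rho ^+ r / r`!%:R * `|derive1n (m.+1 + r) tanh z0|
  + rho ^+ N.+1 * ((m.+1 + N + 1)`!%:R / (N + 1)`!%:R * 2 ^+ (m.+1 + N + 2)
                   * expR (- 2 * Num.max 0 (`|z0| - rho))).
Proof.
move=> zrho; have rho0 : 0 <= rho by apply: le_trans zrho.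
pose d := z - z0.
pose G r s := d ^+ r * derive1n (m.+1 + r) (@tanh R) (z0 + s * d).
have GD r (s : R) : is_derive s 1 (G r) (G r.+1 s).
  rewrite /G exprS.
  have -> : (fun s => d ^+ r * derive1n (m.+1 + r) (@tanh R) (z0 + s * d)) =
     d ^+ r *: (fun s => derive1n (m.+1 + r) (@tanh R) (z0 + s * d)) by apply/funext.
  have := is_derive_comp_affine (derive1n (m.+1 + r) tanh) _ z0 d s
            (is_derive_derive1n_tanh _ _).
  rewrite -addnS => D; apply: is_derive_eq; rewrite /GRing.scale /=; ring.
pose C := rho ^+ N.+1 * ((m.+1 + N.+1)`!%:R * 2 ^+ (m.+1 + N.+1).+1
            * expR (- 2 * Num.max 0 (`|z0| - rho))).
have GC s : 0 <= s <= 1 -> `|G N.+1 s| <= C.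
  move=> /andP[s0 s1]; rewrite normrM normrX ler_pM //.
    by rewrite lerXn2r ?nnegrE.
  apply: le_trans (norm_derive1n_tanh_le _ _) _.
  apply: ler_pM; [exact: mulr_ge0|exact: expR_ge0|exact: lexx|].
  rewrite ler_expR; apply: ler_wnM2l; first by rewrite lerNl oppr0.
  rewrite ge_max normr_ge0 /= lerBlDr.
  have -> : z0 = (z0 + s * d) - s * d by ring.
  apply: le_trans (ler_normB _ _) _; rewrite addrK lerD2l normrM ger0_norm //.
  by apply: le_trans zrho; rewrite ler_piMl.
have := taylor_remainder_le G N.+1 C 1 GD GC 1; rewrite ler01 lexx => /(_ isT).
rewrite big_ord_recl [G _ _]/G !expr0 fact0 divr1 !mul1r addn0.
rewrite /G expr0 !mul1r mul0r addr0 addn0 expr1n mulr1.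
rewrite [z0 + d]addrC subrK opprD addrA; set S := \sum_(i < N) _ => H.
rewrite -[X in `|X| <= _](subrK S) addrC.
apply: le_trans (ler_normD _ _) _; apply: lerD; last first.
  apply: le_trans H _; rewrite /C !addn1 !addnS addn0.
  by apply: le_of_eq; ring.
rewrite big_add1 /= big_mkord; apply: le_trans (ler_norm_sum _ _ _) _.
apply: ler_sum => i _; rewrite lift0 expr1n.
rewrite !normrM normrX normfV normr1 mul1r normr_nat mulrA.
rewrite ler_wpM2r // [leLHS]mulrC ler_wpM2r // lerXn2r ?nnegrE //.
Qed.

End Taylor.

(** * Partitions of a set with one more element *)

Section Partitions.
Context {T : finType}.
Implicit Types (A B J : {set T}) (P Q : {set {set T}}).
Local Open Scope set_scope.
(* partition, cover, set0 below are those of finite sets *)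
Import mathcomp.boot.finset.

(** The partition obtained from the partition q.1 by adding x to its block q.2; the
value set0 of q.2 stands for the creation of a new block [set x]. *)
Definition insert_in_block (x : T) (q : {set {set T}} * {set T}) :=
  (x |: q.2) |: (q.1 :\ q.2).

(** The inverse of [insert_in_block].  Removing set0 discards the empty remainder J of
a block that contained only x. *)
Definition remove_from_block (x : T) P : {set {set T}} * {set T} :=
  let J := pblock P x :\ x in ((J |: (P :\ pblock P x)) :\ set0, J).

Lemma insert_in_block_partition x A Q J : x \notin A -> partition Q A ->
  J \in set0 |: Q -> partition (insert_in_block x (Q, J)) (x |: A).
Proof.
move=> xA QA JQ; rewrite /insert_in_block /=.
have JA : J \subset A.
  by move: JQ; rewrite !inE => /orP[/eqP ->|/(partitionS QA)//]; rewrite sub0set.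
have QJ : partition (Q :\ J) (A :\: J).
  move: JQ; rewrite !inE => /orP[/eqP ->|]; last exact: partitionD1.
  by rewrite setD0 (setDidPl _) // disjoint_sym disjoints1 (partition0 QA).
have -> : x |: A = (x |: J) :|: (A :\: J).
  by rewrite -setUA -[in LHS](setID A J) (setIidPr JA).
apply: partitionU1 => //; first by apply/set0Pn; exists x; rewrite setU11.
rewrite disjoints_subset; apply/fintype.subsetP => z; rewrite !inE.
by case/orP => [/eqP ->|->//]; rewrite (negbTE xA) andbF.
Qed.

Lemma insert_in_blockK x A Q J : x \notin A -> partition Q A ->
  J \in set0 |: Q -> remove_from_block x (insert_in_block x (Q, J)) = (Q, J).
Proof.
move=> xA QA JQ; have QxA := insert_in_block_partition x A Q J xA QA JQ.
rewrite /remove_from_block.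
have JA : J \subset A.
  by move: JQ; rewrite !inE => /orP[/eqP ->|/(partitionS QA)//]; rewrite sub0set.
have xJ : x \notin J by apply: contra xA; apply: (fintype.subsetP JA).
have xJQ : (x |: J \in Q) = false.
  apply/negbTE; apply: contra xA => /(partitionS QA)/fintype.subsetP; apply.
  exact: setU11.
rewrite (def_pblock (partition_trivIset QxA) (B := x |: J)) ?setU11 //.
rewrite (setU1K xJ); congr pair; apply/setP => I; rewrite !inE.
move: JQ; rewrite !inE; have [->|I0] /= := eqVneq I set0.
  by rewrite (partition0 QA).
have [<-|IJ] /= := eqVneq I J; last first.
  by have [->|] //= := eqVneq I (x |: J); rewrite xJQ.
by rewrite (negbTE I0) /= => ->.
Qed.

Lemma remove_from_blockK x A P : partition P (x |: A) ->
  insert_in_block x (remove_from_block x P) = P.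
Proof.
move=> PA; have tP := partition_trivIset PA; have cP := cover_partition PA.
have xP : x \in cover P by rewrite cP setU11.
rewrite /insert_in_block /remove_from_block /=; set B := pblock P x.
have BP : B \in P by rewrite pblock_mem.
have xB : x \in B by rewrite mem_pblock.
rewrite setD1K //; apply/setP => I; rewrite !inE.
have [->//|IB] := eqVneq I B; rewrite /=.
have [IP|] := boolP (I \in P); last first.
  by case: (I == B :\ x) => //=; rewrite andbF.
rewrite (partition_neq0 PA IP) orbT !andbT /=; apply/eqP => IE.
have /set0Pn[z zI] := partition_neq0 PA IP.
have zB : z \in B by move: zI; rewrite IE => /setD1P[].
by case/eqP: IB; rewrite -(def_pblock tP IP zI) (def_pblock tP BP zB).
Qed.

Lemma remove_from_block_partition x A P : x \notin A -> partition P (x |: A) ->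
  partition (remove_from_block x P).1 A /\
  (remove_from_block x P).2 \in set0 |: (remove_from_block x P).1.
Proof.
move=> xA PA; have tP := partition_trivIset PA; have cP := cover_partition PA.
have xP : x \in cover P by rewrite cP setU11.
rewrite /remove_from_block /=; set B := pblock P x; set J := B :\ x.
have BP : B \in P by rewrite pblock_mem.
have xB : x \in B by rewrite mem_pblock.
have PB := partitionD1 PA BP.
split; last by rewrite !inE; case: (J == set0) => //=; rewrite eqxx.
have BA := partitionS PA BP.
have JA : J \subset A by rewrite subDset.
have AE : A = J :|: ((x |: A) :\: B).
  apply/setP => z; rewrite !inE; have [->|zx] /= := eqVneq z x.
    by rewrite xB (negbTE xA).
  have [zB|] //= := boolP (z \in B).
  by have := fintype.subsetP BA z zB; rewrite !inE (negbTE zx).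
have [J0|J0] := eqVneq J set0.
  rewrite J0 setU1K; last by rewrite (partition0 PB).
  by rewrite [A in partition _ A]AE J0 set0U.
have PJ : partition (J |: (P :\ B)) A.
  rewrite [A in partition _ A]AE; apply: partitionU1 => //.
  rewrite disjoints_subset; apply/fintype.subsetP => z /setD1P[_ zB].
  by rewrite !inE zB.
by rewrite (setDidPl _) // disjoint_sym disjoints1 (partition0 PJ).
Qed.

(** Removing x from a partition of x |: A leaves a partition of A, and the original is
recovered from the place of x: alone, or in one of the blocks J. *)
Lemma big_partition_setU1 (V : nmodType) (x : T) A (F : {set {set T}} -> V) :
  x \notin A ->
  (\sum_(P | partition P (x |: A)) F P =
   \sum_(Q | partition Q A)
     (F ([set x] |: Q) + \sum_(J in Q) F ((x |: J) |: (Q :\ J))))%R.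
Proof.
move=> xA; rewrite (reindex_onto (insert_in_block x) (remove_from_block x)).
  have -> : (\sum_(Q | partition Q A)
       (F ([set x] |: Q) + \sum_(J in Q) F ((x |: J) |: (Q :\ J))) =
     \sum_(Q | partition Q A)
        \sum_(J in set0 |: Q) F (insert_in_block x (Q, J)))%R.
    apply: eq_bigr => Q QA; rewrite big_setU1 ?(partition0 QA) //=.
    rewrite /insert_in_block /= setU0 (setDidPl _) //.
    by rewrite disjoint_sym disjoints1 (partition0 QA).
  rewrite pair_big_dep; apply: eq_big => [[Q J]|[Q J] _] //=.
  apply/andP/andP => [[PA /eqP E]|[QA JQ]].
    by have := remove_from_block_partition _ _ _ xA PA; rewrite E.
  by rewrite insert_in_block_partition // (insert_in_blockK _ A).
by move=> P; apply: remove_from_blockK.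
Qed.
End Partitions.

(** * Derivatives along coordinate axes *)

Section DeriveFun.
Context {R : realType} {V : normedModType R}.
Implicit Types (f g : V -> R) (x v : V).

Lemma is_deriveD_fun f g x v df dg : is_derive x v f df -> is_derive x v g dg ->
  is_derive x v (fun y => f y + g y) (df + dg).
Proof. by move=> Df Dg; exact: (is_deriveD Df Dg). Qed.

Lemma is_deriveM_fun f g x v df dg : is_derive x v f df -> is_derive x v g dg ->
  is_derive x v (fun y => f y * g y) (df * g x + f x * dg).
Proof.
by move=> Df Dg; rewrite addrC [df * _]mulrC; exact: (is_deriveM Df Dg).
Qed.

Lemma is_derive_big_sum (I : Type) (r : seq I) (P : pred I) (F : I -> V -> R)
    (dF : I -> R) x v : (forall i, P i -> is_derive x v (F i) (dF i)) ->
  is_derive x v (fun y => \sum_(i <- r | P i) F i y) (\sum_(i <- r | P i) dF i).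
Proof.
move=> FD; elim: r => [|i r IHr].
  rewrite big_nil; under eq_fun do rewrite big_nil.
  exact: is_derive_cst.
rewrite big_cons; under eq_fun do rewrite big_cons.
case: ifP => // Pi; apply: is_deriveD_fun => //; exact: FD.
Qed.

Lemma is_derive_big_prod (I : finType) (A : {set I}) (F : I -> V -> R)
    (dF : I -> R) x v : (forall i, is_derive x v (F i) (dF i)) ->
  is_derive x v (fun y => \prod_(i in A) F i y)
    (\sum_(j in A) dF j * \prod_(i in A :\ j) F i x).
Proof.
move=> FD.
have -> : \sum_(j in A) dF j * \prod_(i in A :\ j) F i x =
    \sum_(j <- enum A) dF j * \prod_(i <- enum A | i != j) F i x.
  rewrite big_enum; apply: eq_bigr => j _; congr (_ * _).
  rewrite big_enum_cond; apply: eq_bigl => i; rewrite !inE andbC //.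
under eq_fun do rewrite -big_enum.
elim: (enum A) (enum_uniq A) => [_|a r IHr /= /andP[ar ur]].
  rewrite big_nil; under eq_fun do rewrite big_nil.
  exact: is_derive_cst.
rewrite !big_cons eqxx /=; under eq_fun do rewrite big_cons.
have -> : \prod_(i <- r | i != a) F i x = \prod_(i <- r) F i x.
  rewrite big_seq_cond [RHS]big_seq; apply: eq_bigl => i.
  by have [ir|//] := boolP (i \in r); apply: contraNneq ar => <-.
have -> : \sum_(j <- r) dF j * \prod_(i <- a :: r | i != j) F i x =
    F a x * \sum_(j <- r) dF j * \prod_(i <- r | i != j) F i x.
  rewrite mulr_sumr [LHS]big_seq [RHS]big_seq; apply: eq_bigr => j jr.
  rewrite big_cons; have -> : a != j by apply: contraNneq ar => ->.
  by rewrite mulrCA.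
exact: is_deriveM_fun (FD a) (IHr ur).
Qed.

Lemma derive_line_quotient f x v t :
  (fun h : R => h^-1 *: ((f \o shift (t *: v + x)) (h *: v) - f (t *: v + x))) =
  (fun h : R => h^-1 *: (((fun s => f (s *: v + x)) \o shift t) (h *: 1)
                         - f (t *: v + x))).
Proof.
by apply/funext => h /=; rewrite [h *: 1]mulr1 scalerDl addrA.
Qed.

(** A derivative in direction v is a one-variable derivative along the line, which
transfers one-variable results (chain rule, mean value theorem). *)
Lemma is_derive_line f x v t d :
  is_derive (t *: v + x) v f d <-> is_derive t 1 (fun s => f (s *: v + x)) d.
Proof.
split=> [[fD fd]|[fD fd]]; split.
- by move: fD; rewrite /derivable derive_line_quotient.
- by move: fd; rewrite /derive derive_line_quotient.
- by rewrite /derivable derive_line_quotient.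
- by rewrite /derive derive_line_quotient.
Qed.

Lemma is_derive_comp_dir (G : R -> R) (f : V -> R) x v a b :
  is_derive (f x) 1 G a -> is_derive x v f b ->
  is_derive x v (fun y => G (f y)) (a * b).
Proof.
move=> GD fD.
have x0 : x = 0 *: v + x by rewrite scale0r add0r.
rewrite x0; apply/is_derive_line.
apply: (is_derive1_comp (f := G) (g := fun s => f (s *: v + x))).
  by rewrite -x0.
by apply/is_derive_line; rewrite -x0.
Qed.

End DeriveFun.

Section IteratedPartials.
Context {R : realType} {n : nat}.
Local Notation V := 'cV[R]_n.
Implicit Types (ds : seq 'I_n) (g : V -> R) (x : V).

Definition axis (l : 'I_n) : V := delta_mx l 0.

Definition dpart ds g : V -> R :=
  foldr (fun l (h : V -> R) x => 'D_(axis l) h x) g ds.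

(** All iterated partial derivatives exist.  This class contains the coordinates, is
stable under affine combinations and under composition with tanh, hence contains
every z^k, and it gives what the chain rule and the mean value inequality along
an axis require. *)
Definition smooth g := forall ds l x, derivable (dpart ds g) x (axis l).

Lemma is_derive_dpart g : smooth g -> forall ds l x,
  is_derive x (axis l) (dpart ds g) (dpart (l :: ds) g x).
Proof. by move=> gs ds l x; apply: derivableP. Qed.

Lemma dpart_cat ds1 ds2 g : dpart (ds1 ++ ds2) g = dpart ds1 (dpart ds2 g).
Proof. exact: foldr_cat. Qed.

Lemma dpart_cst ds (c : R) :
  dpart ds (fun=> c) = fun=> if ds is [::] then c else 0.
Proof.
elim: ds => //= l ds ->; apply/funext => x; exact: derive_cst.
Qed.

Lemma dpart_coord1 l j : dpart [:: l] (fun x => x j 0) = fun=> (j == l)%:R.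
Proof.
apply/funext => u /=.
have := derive_mx (derivable_id (x := u) (v := axis l)); rewrite derive_id.
move=> /matrixP/(_ j 0); rewrite [LHS]mxE eqxx andbT => ->.
by rewrite mxE.
Qed.

Lemma smooth_coord j : smooth (fun x => x j 0).
Proof.
move=> ds l x; case/lastP: ds => [|ds l'].
  by apply: diff_derivable; exact: differentiable_coord.
by rewrite -cats1 dpart_cat dpart_coord1 dpart_cst; exact: derivable_cst.
Qed.

Lemma smooth_affine m (c : 'I_m -> R) (b : R) (h : 'I_m -> V -> R) :
  (forall j, smooth (h j)) ->
  (forall ds, ds != [::] -> dpart ds (fun x => \sum_j c j * h j x + b) =
                            fun x => \sum_j c j * dpart ds (h j) x) /\
  smooth (fun x => \sum_j c j * h j x + b).
Proof.
move=> hs.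
have D ds l x : is_derive x (axis l) (fun x => \sum_j c j * dpart ds (h j) x)
    (\sum_j c j * dpart (l :: ds) (h j) x).
  apply: is_derive_big_sum => j _.
  exact: (is_deriveZ (c j) (is_derive_dpart (h j) (hs j) ds l x)).
have D0 l x : is_derive x (axis l) (fun x => \sum_j c j * h j x + b)
    (\sum_j c j * dpart [:: l] (h j) x).
  rewrite -[X in is_derive _ _ _ X]addr0.
  exact: is_deriveD_fun (D [::] l x) (is_derive_cst b x (axis l)).
have E ds : ds != [::] -> dpart ds (fun x => \sum_j c j * h j x + b) =
                          fun x => \sum_j c j * dpart ds (h j) x.
  elim: ds => // l [_ _|l' ds IHds _].
    by apply/funext => x; exact: (@derive_val _ _ _ _ _ _ _ (D0 l x)).
  have /= -> := IHds isT; apply/funext => x.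
  exact: (@derive_val _ _ _ _ _ _ _ (D (l' :: ds) l x)).
split=> // -[|l' ds] l x; first exact: (@ex_derive _ _ _ _ _ _ _ (D0 l x)).
by rewrite E //; exact: (@ex_derive _ _ _ _ _ _ _ (D (l' :: ds) l x)).
Qed.

(** One coordinate is changed at a time.  The intermediate points have each
coordinate equal to that of x or of y, so the path stays in the box, and each of
its n steps is an instance of the one-variable mean value theorem. *)
Lemma box_mean_value g (C : 'I_n -> R) (eps y x : V) :
  (forall l u, derivable g u (axis l)) ->
  (forall l u, in_box eps y u -> `|dpart [:: l] g u| <= C l) ->
  in_box eps y x -> `|g x - g y| <= \sum_l C l * eps l 0.
Proof.
move=> gD gC xy.
have eps0 l : 0 <= eps l 0 by apply: le_trans (xy l).
have C0 l : 0 <= C l.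
  by apply: le_trans (gC l y _) => // j; rewrite subrr normr0.
(* u k has its first k coordinates from x and the others from y *)
pose u k : V := \col_(j < n) if (j < k)%N then x j 0 else y j 0.
have u0 : u 0%N = y by apply/matrixP => i j; rewrite mxE ord1.
have un : u n = x by apply/matrixP => i j; rewrite mxE ord1 ltn_ord.
suff H k : (k <= n)%N ->
    `|g (u k) - g y| <= \sum_(l < n | (l < k)%N) C l * eps l 0.
  rewrite -un; apply: le_trans (H n (leqnn _)) _.
  by apply/le_of_eq/eq_bigl => l; rewrite ltn_ord.
elim: k => [_|k IHk kn].
  by rewrite u0 subrr normr0 sumr_ge0 // => l _; rewrite mulr_ge0.
pose l := Ordinal kn; pose d := x l 0 - y l 0.
have uS s : s *: (d *: axis l) + u k =
   \col_(j < n) if (j == l) then y j 0 + s * d else u k j 0.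
  apply/matrixP => i j; rewrite !mxE ord1 eqxx andbT.
  have [->|il] := eqVneq i l; last by rewrite !mulr0 add0r.
  by rewrite /= ltnn mulr1 addrC.
have uk1 : u k.+1 = 1 *: (d *: axis l) + u k.
  rewrite uS; apply/matrixP => i j; rewrite !mxE mul1r ltnS leq_eqVlt.
  have [->|il] := eqVneq i l; first by rewrite eqxx /= addrC subrK.
  by rewrite -(inj_eq val_inj) /= in il; rewrite (negbTE il).
have box s : 0 <= s <= 1 -> in_box eps y (s *: (d *: axis l) + u k).
  move=> /andP[s0 s1] j; rewrite uS mxE; case: eqP => [->|_].
    rewrite addrC addKr normrM ger0_norm //.
    by apply: le_trans (xy l); rewrite ler_piMl.
  by rewrite mxE; case: ifP => // _; rewrite subrr normr0.
have FD (s : R) : is_derive s 1 (fun s => g (s *: (d *: axis l) + u k))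
    (d * dpart [:: l] g (s *: (d *: axis l) + u k)).
  have E r : r *: (d *: axis l) + u k = (0 + r * d) *: axis l + u k.
    by rewrite add0r scalerA.
  rewrite E; under eq_fun do rewrite E.
  apply: (is_derive_comp_affine (fun r => g (r *: axis l + u k))).
  exact: (iffLR (is_derive_line g (u k) (axis l) (0 + s * d) _) (derivableP (gD l _))).
have [s] : exists2 s, s \in `[0, 1]%R &
    g (1 *: (d *: axis l) + u k) - g (0 *: (d *: axis l) + u k) =
    d * dpart [:: l] g (s *: (d *: axis l) + u k) * (1 - 0).
  apply: (@MVT_segment R (fun s => g (s *: (d *: axis l) + u k)) _ 0 1) => //.
  apply: derivable_within_continuous => s _.
  exact: (@ex_derive _ _ _ _ _ _ _ (FD s)).
rewrite in_itv /= => sI; rewrite -uk1 scale0r add0r subr0 mulr1 => E.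
rewrite -(subrK (g (u k)) (g (u k.+1))) E -addrA.
apply: le_trans (ler_normD _ _) _.
rewrite (bigD1 l) //=; apply: lerD.
  rewrite normrM mulrC; apply: ler_pM => //; [exact: gC (box _ sI)|exact: xy].
apply: le_trans (IHk (ltnW kn)) _.
apply/le_of_eq/eq_bigl => j.
by rewrite ltnS -(inj_eq val_inj) /= ltn_neqAle andbC.
Qed.

End IteratedPartials.

(** * Multi-indices and Faa di Bruno's formula *)

Lemma sorted_enum_ord s (I : {set 'I_s}) :
  sorted (fun i j : 'I_s => (i < j)%N) (enum I).
Proof.
rewrite {1}/enum_mem -enumT; apply: sorted_filter; first by move=> ? ? ?; apply: ltn_trans.
have := iota_ltn_sorted 0 s; rewrite -val_enum_ord sorted_map.
by apply: sub_sorted.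
Qed.

(** Adding an index smaller than those of a block puts a direction in front of the
directions of the block, that is, applies one more outermost derivative. *)
Lemma enum_setU1_least s (i0 : 'I_s) (I : {set 'I_s}) :
  (forall i, i \in I -> (i0 < i)%N) -> enum (i0 |: I)%SET = i0 :: enum I.
Proof.
move=> lt_i0; apply: (irr_sorted_eq (leT := fun i j : 'I_s => (i < j)%N)).
- by move=> ? ? ?; apply: ltn_trans.
- by move=> i; rewrite ltnn.
- exact: sorted_enum_ord.
- rewrite /= path_min_sorted ?sorted_enum_ord //.
  by apply/allP => i; rewrite mem_enum => /lt_i0.
- by move=> i; rewrite inE !mem_enum !inE.
Qed.

Section Directions.
Context {n : nat}.

Definition dirs (ds : seq 'I_n) (I : {set 'I_(size ds)}) : seq 'I_n :=
  [seq tnth (in_tuple ds) i | i <- enum I].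

Lemma dirs_setT ds : dirs ds [set: 'I_(size ds)]%SET = ds.
Proof.
rewrite /dirs (eq_enum (B := 'I_(size ds))); last by move=> i; rewrite !inE.
by rewrite map_tnth_enum.
Qed.

Implicit Types alpha : multiindex n.

Lemma count_midx_dirs alpha j : count_mem j (midx_dirs alpha) = alpha j.
Proof.
rewrite /midx_dirs count_flatten -map_comp sumnE big_map big_enum /=.
rewrite (bigD1 j) //= count_nseq /= eqxx mul1n big1 ?addn0 // => i ij.
by rewrite count_nseq /= (negbTE ij) mul0n.
Qed.

Lemma size_midx_dirs alpha : size (midx_dirs alpha) = midx_deg alpha.
Proof.
rewrite /midx_dirs size_flatten /shape -map_comp sumnE big_map big_enum /=.
by apply: eq_bigr => i _; rewrite size_nseq.
Qed.

Lemma midx_dirs_inj : injective (@midx_dirs n).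
Proof. by move=> a b E; apply/ffunP => j; rewrite -!count_midx_dirs E. Qed.

Local Notation leord := (fun i j : 'I_n => (i <= j)%N).

Let leord_trans : transitive leord.
Proof. by move=> ? ? ?; apply: leq_trans. Qed.

Lemma sorted_midx_dirs alpha : sorted leord (midx_dirs alpha).
Proof.
rewrite sorted_pairwise // /midx_dirs.
have : sorted leord (enum 'I_n).
  have := iota_sorted 0 n; rewrite -val_enum_ord sorted_map.
  by apply: sub_sorted.
rewrite sorted_pairwise //; elim: (enum 'I_n) => //= i r IHr /andP[ir /IHr rr].
rewrite pairwise_cat rr andbT; apply/andP; split.
  apply/allrelP => a b; rewrite mem_nseq => /andP[_ /eqP ->].
  by move=> /flatten_mapP[j jr]; rewrite mem_nseq => /andP[_ /eqP ->]; exact: (allP ir).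
by rewrite -sorted_pairwise //; elim: (alpha i) => //= -[|m] //= ->; rewrite leqnn.
Qed.

(** Both sequences are sorted and contain each direction the same number of times.
This identifies the blocks of [faa_di_bruno], which are sets of positions, with
the multi-indices on which the algorithm recurses. *)
Lemma midx_dirs_block alpha (I : midx_subset alpha) :
  midx_dirs (midx_block I) = dirs (midx_dirs alpha) I.
Proof.
apply: (sorted_eq (leT := leord)) => //.
- by move=> i j ij; apply/val_inj/anti_leq.
- exact: sorted_midx_dirs.
- rewrite /dirs sorted_map; apply: sub_sorted (sorted_enum_ord _ I) => i j ij.
  have x0 : 'I_n := tnth (in_tuple (midx_dirs alpha)) i.
  rewrite /= !(tnth_nth x0).
  apply: (sorted_leq_nth leord_trans (leqnn : reflexive leord)); last exact: ltnW.
  + exact: sorted_midx_dirs.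
  + by rewrite inE /=.
  + by rewrite inE /=.
apply/allP => j _ /=; apply/eqP; rewrite count_midx_dirs ffunE /dirs.
rewrite -sum1_count big_map big_enum_cond /= big_mkcondr /=.
by apply: eq_bigr => i _; rewrite ffunE eq_sym; case: eqP.
Qed.

Lemma size_dirs ds I : size (dirs ds I) = #|I|.
Proof. by rewrite size_map cardE. Qed.

Lemma midx_deg_block alpha (I : midx_subset alpha) : midx_deg (midx_block I) = #|I|.
Proof. by rewrite -size_midx_dirs midx_dirs_block size_dirs. Qed.

(** The only block of full size is the whole set of positions, whose multi-index is
alpha. *)
Lemma midx_deg_block_lt alpha (I : midx_subset alpha) :
  midx_block I != alpha -> (midx_deg (midx_block I) < midx_deg alpha)%N.
Proof.
move=> Ia; rewrite midx_deg_block -size_midx_dirs.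
have := max_card (mem I); rewrite card_ord leq_eqVlt => /orP[/eqP cI|//].
case/eqP: Ia; apply: midx_dirs_inj; rewrite midx_dirs_block.
suff -> : I = [set: _]%SET by rewrite dirs_setT.
by apply/eqP; rewrite eqEcard finset.subsetT cardsT card_ord cI leqnn.
Qed.

Lemma midx_dirs_unit (l : 'I_n) : midx_dirs (midx_unit l) = [:: l].
Proof.
have sz : size (midx_dirs (midx_unit l)) = 1%N.
  rewrite size_midx_dirs /midx_deg (bigD1 l) //= ffunE eqxx big1 // => i il.
  by rewrite ffunE (negbTE il).
have := count_midx_dirs (midx_unit l) l; rewrite ffunE eqxx.
by case: (midx_dirs _) sz => [|a [|b r]] //= _; case: eqP => // ->.
Qed.

Lemma midx_deg1 alpha : midx_deg alpha = 1%N -> exists l, alpha = midx_unit l.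
Proof.
rewrite -size_midx_dirs => sz.
case E : (midx_dirs alpha) sz => [|l [|b r]] // _.
by exists l; apply: midx_dirs_inj; rewrite midx_dirs_unit.
Qed.

End Directions.

Section FaaDiBruno.
Context {R : realType} {n : nat} (G : nat -> R -> R).
Context (GD : forall m (t : R), is_derive t 1 (G m) (G m.+1 t)).
Local Notation V := 'cV[R]_n.
Implicit Types (ds : seq 'I_n) (g : V -> R) (x : V).

Definition fdb_term ds g (P : {set {set 'I_(size ds)}}) x : R :=
  G #|P| (g x) * \prod_(I in P) dpart (dirs ds I) g x.

(** Differentiating the outer factor creates the block [set i]; differentiating the
factor of a block J replaces J by i |: J.  These are the partitions listed in
[big_partition_setU1]. *)
Lemma is_derive_fdb_term ds g P (i : 'I_(size ds)) (A : {set 'I_(size ds)}) x :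
  smooth g -> (forall j, j \in A -> (i < j)%N) -> finset.partition P A ->
  is_derive x (axis (tnth (in_tuple ds) i)) (fdb_term ds g P)
    (fdb_term ds g ([set i] |: P)%SET x
     + \sum_(J in P) fdb_term ds g ((i |: J) |: (P :\ J))%SET x).
Proof.
move=> gs iA PA; set l := tnth _ _.
have iNA : i \notin A by apply/negP => /iA; rewrite ltnn.
have dirsU1 (J : {set 'I_(size ds)}) : J \subset A -> dirs ds (i |: J)%SET = l :: dirs ds J.
  move=> JA; rewrite /dirs enum_setU1_least // => j jJ; apply: iA.
  exact: (fintype.subsetP JA).
have iNP (J : {set 'I_(size ds)}) : (i |: J)%SET \notin P.
  apply: contra iNA => /(partitionS PA)/fintype.subsetP; apply; exact: setU11.
have GgD := is_derive_comp_dir _ _ _ _ _ _ (GD #|P| (g x)) (is_derive_dpart g gs [::] l x).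
have prodD := is_derive_big_prod _ P (fun I => dpart (dirs ds I) g) _ x (axis l)
  (fun I => is_derive_dpart g gs (dirs ds I) l x).
have := is_deriveM_fun _ _ _ _ _ _ GgD prodD.
congr (is_derive _ _ _ _); congr (_ + _).
  rewrite /fdb_term cardsU1 -[[set i]%SET]finset.setU0 iNP add1n big_setU1 //= mulrA.
  by rewrite dirsU1 ?finset.sub0set // /dirs finset.enum_set0.
rewrite mulr_sumr; apply: eq_bigr => J JP.
rewrite /fdb_term cardsU1 !inE (negbTE (iNP J)) andbF.
have -> : (true + #|(P :\ J)%SET|)%N = #|P| by rewrite [RHS](cardsD1 J) JP.
rewrite big_setU1 /=; last by rewrite !inE (negbTE (iNP J)) andbF.
by rewrite dirsU1 // (partitionS PA).
Qed.

(** The outermost derivative is the first of ds, so the induction runs over the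
suffixes of ds.  Their positions are kept as subsets of the fixed type of
positions in ds, so that partitions of different suffixes have the same type. *)
Lemma faa_di_bruno_suffix ds g : smooth g -> forall k, (k <= size ds)%N ->
  dpart (drop (size ds - k) ds) (fun x => G 0%N (g x)) =
  fun x => \sum_(P : {set {set 'I_(size ds)}} | finset.partition P
               [set i : 'I_(size ds) | (size ds - k <= i)%N]%SET) fdb_term ds g P x.
Proof.
move=> gs; elim=> [_|k IHk kn].
  rewrite subn0 drop_size /=; apply/funext => x.
  have -> : [set i : 'I_(size ds) | (size ds <= i)%N]%SET = finset.set0.
    by apply/setP => i; rewrite !inE leqNgt ltn_ord.
  under eq_bigl do rewrite partition_set0.
  by rewrite big_pred1_eq /fdb_term cards0 big_set0 mulr1.
have jn : (size ds - k.+1 < size ds)%N by lia.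
pose i := Ordinal jn.
have dropE : drop (size ds - k.+1) ds =
    tnth (in_tuple ds) i :: drop (size ds - k) ds.
  have x0 : 'I_n := tnth (in_tuple ds) i.
  rewrite (drop_nth x0) // (tnth_nth x0) /=.
  by congr (_ :: drop _ _); lia.
set A := [set j : 'I_(size ds) | (size ds - k <= j)%N]%SET in IHk *.
have iA j : j \in A -> (i < j)%N by rewrite inE /=; lia.
have -> : [set j : 'I_(size ds) | (size ds - k.+1 <= j)%N]%SET = (i |: A)%SET.
  by apply/setP => j; rewrite !inE -(inj_eq val_inj) /=; lia.
rewrite dropE /= IHk ?(ltnW kn) //; apply/funext => x.
rewrite big_partition_setU1; last by apply/negP => /iA; rewrite ltnn.
have D := is_derive_big_sum _ (index_enum _) (fun P => finset.partition P A)
  (fun P => fdb_term ds g P) _ x (axis (tnth (in_tuple ds) i))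
  (fun P PA => is_derive_fdb_term ds g P i A x gs iA PA).
exact: (@derive_val _ _ _ _ _ _ _ D).
Qed.

Lemma faa_di_bruno ds g : smooth g ->
  dpart ds (fun x => G 0%N (g x)) =
  fun x => \sum_(P | finset.partition P [set: 'I_(size ds)]%SET) fdb_term ds g P x.
Proof.
move=> gs; have := faa_di_bruno_suffix ds g gs (size ds) (leqnn _).
rewrite subnn drop0 => ->; apply/funext => x; apply: eq_bigl => P.
by congr finset.partition; apply/setP => i; rewrite !inE.
Qed.

(** The formula of Faa di Bruno expresses each iterated derivative through functions
that can be differentiated once more. *)
Lemma smooth_comp g : smooth g -> smooth (fun x => G 0%N (g x)).
Proof.
move=> gs ds l x; rewrite faa_di_bruno //.
have T (P : {set {set 'I_(size ds)}}) : exists d, is_derive x (axis l) (fdb_term ds g P) d.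
  have GgD := is_derive_comp_dir _ _ _ _ _ _ (GD #|P| (g x)) (is_derive_dpart g gs [::] l x).
  have prodD := is_derive_big_prod _ P (fun I => dpart (dirs ds I) g) _ x (axis l)
    (fun I => is_derive_dpart g gs (dirs ds I) l x).
  eexists; exact: (is_deriveM_fun _ _ _ _ _ _ GgD prodD).
have TD P := projT2 (cid (T P)).
have D := is_derive_big_sum _ (index_enum _)
  (fun P => finset.partition P [set: 'I_(size ds)]%SET)
  (fun P => fdb_term ds g P) _ x (axis l) (fun P _ => TD P).
exact: (@ex_derive _ _ _ _ _ _ _ D).
Qed.

End FaaDiBruno.

(** * Perturbation of products and of affine maps *)

Section Dominated.
Context {R : realType}.
Implicit Types u v U V P : R.

(** The form in which the algorithms bound an increment: U bounds |u'|, and U - |u|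
bounds |u' - u|. *)
Definition dominated u' u U := `|u' - u| <= U - `|u|.

Lemma dominated_norm u' u U : dominated u' u U -> `|u'| <= U.
Proof.
rewrite /dominated lerBrDr => H; apply: le_trans H.
by rewrite -[X in `|X| <= _](subrK u) ler_normD.
Qed.

Lemma dominated_add u' u P : `|u' - u| <= P -> dominated u' u (`|u| + P).
Proof. by rewrite /dominated [`|u| + P]addrC addrK. Qed.

(** u'v' - uv = u'(v' - v) + (u' - u)v is bounded by U(V - |v|) + (U - |u|)|v|, and
the mixed terms cancel. *)
Lemma dominatedM u' u U v' v V :
  dominated u' u U -> dominated v' v V -> dominated (u' * v') (u * v) (U * V).
Proof.
move=> Du Dv; have u'U := dominated_norm _ _ _ Du.
rewrite /dominated.
have -> : u' * v' - u * v = u' * (v' - v) + (u' - u) * v by ring.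
apply: le_trans (ler_normD _ _) _; rewrite !normrM.
have -> : U * V - `|u| * `|v| = U * (V - `|v|) + (U - `|u|) * `|v| by ring.
by apply: lerD; rewrite ler_pM.
Qed.

Lemma dominated_prod (I : Type) (r : seq I) (Q : pred I) (u' u U : I -> R) :
  (forall i, Q i -> dominated (u' i) (u i) (U i)) ->
  dominated (\prod_(i <- r | Q i) u' i) (\prod_(i <- r | Q i) u i)
            (\prod_(i <- r | Q i) U i).
Proof.
move=> D; elim/big_ind3: _ => //; first by rewrite /dominated normr1 !subrr normr0.
by move=> *; apply: dominatedM.
Qed.

Lemma dominated_sum (I : Type) (r : seq I) (Q : pred I) (u' u U : I -> R) :
  (forall i, Q i -> dominated (u' i) (u i) (U i)) ->
  `|\sum_(i <- r | Q i) u' i - \sum_(i <- r | Q i) u i|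
    <= \sum_(i <- r | Q i) (U i - `|u i|).
Proof.
by move=> D; rewrite -sumrB; apply: le_trans (ler_norm_sum _ _ _) (ler_sum _ D).
Qed.

Lemma affine_layer_dist (p q s : nat) (W : 'M[R]_(p, q)) (B : 'M[R]_(q, s))
    (u' u : 'I_q -> R) i l :
  (forall j, `|u' j - u j| <= B j l) ->
  `|\sum_j W i j * u' j - \sum_j W i j * u j| <= (absmx W *m B) i l.
Proof.
move=> D; rewrite -sumrB mxE; apply: le_trans (ler_norm_sum _ _ _) _.
by apply: ler_sum => j _; rewrite -mulrBr normrM [absmx _ _ _]mxE ler_wpM2l.
Qed.

End Dominated.

(** * The algorithms *)

Section Network.
Context {R : realType} {n w : nat} (f : network R n w).
Context (N : nat -> nat) (y eps : 'cV[R]_n).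
Local Notation V := 'cV[R]_n.
Local Notation z k i := (fun x : V => preact f k x i 0).
Local Notation a k i := (fun x : V => tanh (preact f k x i 0)).
Local Notation mu := (fun m => derive1n m (@tanh R)).

Lemma mudE w' m (v : 'cV[R]_w') i : mud m v i 0 = derive1n m tanh (v i 0).
Proof. by rewrite mxE. Qed.

Lemma partialE g (gamma : multiindex n) : partial gamma g = dpart (midx_dirs gamma) g :> (V -> R).
Proof. by []. Qed.

Lemma preact1E i : z 1 i = fun x => \sum_j Win f i j * x j 0 + bin f i 0.
Proof. by apply/funext => x; rewrite !mxE. Qed.

Lemma preactSE k i : z k.+2 i =
  fun x => \sum_j Whid f k.+2 i j * a k.+1 j x + bhid f k.+2 i 0.
Proof.
by apply/funext => x; rewrite !mxE; congr (_ + _); apply: eq_bigr => j _; rewrite mxE.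
Qed.

Lemma network_funE L : network_fun f L =
  fun x => \sum_j Wout f 0 j * a L j x + bout f.
Proof.
by apply/funext => x; rewrite /network_fun mxE; congr (_ + _); apply: eq_bigr => j _; rewrite mxE.
Qed.

Lemma smooth_preact k i : smooth (z k.+1 i).
Proof.
elim: k i => [|k IHk] i.
  by rewrite preact1E; apply: (smooth_affine _ _ _ _ _).2 => j; exact: smooth_coord.
rewrite preactSE; apply: (smooth_affine _ _ _ _ _).2 => j.
exact: (smooth_comp (fun m => mu m) is_derive_derive1n_tanh).
Qed.

Lemma smooth_act k i : smooth (a k.+1 i).
Proof.
exact: (smooth_comp (fun m => mu m) is_derive_derive1n_tanh _ (smooth_preact k i)).
Qed.

Lemma dpart_preact1 ds i : ds != [::] ->
  dpart ds (z 1 i) = fun x => \sum_j Win f i j * dpart ds (fun x => x j 0) x.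
Proof.
by move=> ds0; rewrite preact1E (smooth_affine _ _ _ _ _).1 // => j; exact: smooth_coord.
Qed.

Lemma jacobian_preact1 l i x : dpart [:: l] (z 1 i) x = Win f i l.
Proof.
rewrite dpart_preact1 // (bigD1 l) // dpart_coord1 eqxx mulr1 big1 => [|j jl].
  exact: addr0.
by rewrite dpart_coord1 (negbTE jl) mulr0.
Qed.

Lemma dpart_preact1_ge2 ds i : (1 < size ds)%N -> dpart ds (z 1 i) = fun=> 0.
Proof.
case/lastP: ds => [|ds l] //; rewrite size_rcons ltnS => ds0.
rewrite dpart_preact1; last by rewrite -size_eq0 size_rcons.
apply/funext => x; rewrite big1 // => j _; rewrite -cats1 dpart_cat dpart_coord1 dpart_cst.
by case: ds ds0 => // ? ? _; rewrite mulr0.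
Qed.

Lemma dpart_preactS k ds i : ds != [::] -> dpart ds (z k.+2 i) =
  fun x => \sum_j Whid f k.+2 i j * dpart ds (a k.+1 j) x.
Proof.
move=> ds0; rewrite preactSE (smooth_affine _ _ _ _ _).1 // => j.
exact: smooth_act.
Qed.

Lemma dpart_act1 k l j x : dpart [:: l] (a k.+1 j) x =
  mu 1%N (preact f k.+1 x j 0) * dpart [:: l] (z k.+1 j) x.
Proof.
have D := is_derive_comp_dir _ _ _ _ _ _
  (is_derive_derive1n_tanh 0 (preact f k.+1 x j 0))
  (is_derive_dpart _ (smooth_preact k j) [::] l x).
exact: (@derive_val _ _ _ _ _ _ _ D).
Qed.

(** The meaning of the pair computed by [alg1] at layer k: the Jacobian of z^k at the
centre, and a bound on its variation over the box. *)
Definition alg1_valid k := forall i l,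
  (alg1 f N y eps k).1 i l = dpart [:: l] (z k i) y /\
  forall x, in_box eps y x ->
    `|dpart [:: l] (z k i) x - dpart [:: l] (z k i) y| <= (alg1 f N y eps k).2 i l.

Lemma alg1_phat_dominates k : alg1_valid k -> forall i l x, in_box eps y x ->
  dominated (dpart [:: l] (z k i) x) (dpart [:: l] (z k i) y)
            (alg1_phat (alg1 f N y eps k) i l).
Proof.
move=> H i l x xb; have [E /(_ x xb) B] := H i l.
by rewrite 2!mxE E; apply: dominated_add.
Qed.

(** The radius [alg1_rho] is the mean value bound, with the derivatives bounded
on the whole box by the widened Jacobian. *)
Lemma alg1_rho_dist k : alg1_valid k.+1 -> forall i x, in_box eps y x ->
  `|preact f k.+1 x i 0 - preact f k.+1 y i 0|
    <= alg1_rho eps (alg1 f N y eps k.+1) i 0.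
Proof.
move=> H i x xb; rewrite mxE.
apply: (box_mean_value (z k.+1 i)) => // [l u|l u ub].
  exact: (smooth_preact k i [::]).
exact: dominated_norm (alg1_phat_dominates _ H i l u ub).
Qed.

Lemma alg1_Q_dist m k : alg1_valid k.+1 -> forall i x, in_box eps y x ->
  `|mu m.+1 (preact f k.+1 x i 0) - mu m.+1 (preact f k.+1 y i 0)|
    <= alg1_Q f N y eps m.+1 k.+1 i 0.
Proof.
move=> H i x xb; rewrite /alg1_Q mxE.
apply: le_trans (derive1n_tanh_dist _ (N m.+1) _ _ _ (alg1_rho_dist _ H i x xb)) _.
apply: le_of_eq; congr (_ + _).
by apply: eq_bigr => r _; rewrite mudE.
Qed.

Lemma alg2_M_dominates m k : (0 < m)%N -> alg1_valid k.+1 ->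
  forall i x, in_box eps y x ->
  dominated (mu m (preact f k.+1 x i 0)) (mu m (preact f k.+1 y i 0))
            (alg2_M f N y eps m k.+1 i 0).
Proof.
case: m => // m _ H i x xb; rewrite 3!mxE.
by apply: dominated_add; apply: alg1_Q_dist.
Qed.

Lemma alg1_valid_layer k : alg1_valid k.+1.
Proof.
elim: k => [|k IHk] i l.
  by split=> [|x _]; rewrite !jacobian_preact1 // subrr normr0 mxE.
split.
  rewrite dpart_preactS // [LHS]mxE; apply: eq_bigr => j _; congr (_ * _).
  by rewrite dpart_act1 !mxE (IHk j l).1.
move=> x xb; rewrite dpart_preactS //.
apply: affine_layer_dist => j; rewrite !dpart_act1.
have M1 := alg2_M_dominates 1 k isT IHk j x xb.
have := dominatedM _ _ _ _ _ _ M1 (alg1_phat_dominates _ IHk j l x xb).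
rewrite /dominated => /le_trans; apply; apply: le_of_eq.
rewrite [RHS]mxE; congr (_ + _); first by rewrite [RHS]mxE.
by rewrite !mxE (IHk j l).1.
Qed.

Section Step.
Context (Plow : multiindex n -> nat -> 'cV[R]_w) (alpha : multiindex n).
Context (alpha_ge2 : (2 <= midx_deg alpha)%N).
Context (Plow_valid : forall gamma k i x,
  (0 < midx_deg gamma < midx_deg alpha)%N -> in_box eps y x ->
  `|partial gamma (z k.+1 i) x - partial gamma (z k.+1 i) y| <= Plow gamma k.+1 i 0).

(** The analogue of [alg1_valid] for the derivative of multi-index alpha. *)
Definition alg2_valid k (pP : 'cV[R]_w * 'cV[R]_w) := forall i,
  pP.1 i 0 = partial alpha (z k i) y /\
  forall x, in_box eps y x ->
    `|partial alpha (z k i) x - partial alpha (z k i) y| <= pP.2 i 0.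

Lemma alg2_pE k pP : alg2_valid k pP -> forall gamma i,
  alg2_p f y alpha k pP gamma i 0 = partial gamma (z k i) y.
Proof.
move=> H gamma i; rewrite /alg2_p; case: eqP => [->|_]; first exact: (H i).1.
by rewrite mxE.
Qed.

(** A block has multi-index alpha, which is treated by the current step, or a smaller
degree, where the bounds of lower order apply. *)
Lemma alg2_phat_dominates k pP : alg2_valid k.+1 pP ->
  forall (I : midx_subset alpha) i x, I != finset.set0 -> in_box eps y x ->
  dominated (partial (midx_block I) (z k.+1 i) x)
            (partial (midx_block I) (z k.+1 i) y)
            (alg2_phat f y Plow alpha k.+1 pP (midx_block I) i 0).
Proof.
move=> H I i x I0 xb; rewrite 2!mxE alg2_pE //; apply: dominated_add.
rewrite /alg2_P; case: eqP => [->|/eqP Ia]; first exact: (H i).2.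
apply: Plow_valid => //; rewrite midx_deg_block_lt // midx_deg_block.
by rewrite card_gt0 I0.
Qed.

Lemma partial_act k i x : partial alpha (a k.+1 i) x =
  \sum_(P : {set midx_subset alpha} | midx_partition P)
     mu #|P| (preact f k.+1 x i 0)
     * \prod_(I in P) partial (midx_block I) (z k.+1 i) x.
Proof.
rewrite partialE.
rewrite (faa_di_bruno (fun m => mu m) is_derive_derive1n_tanh _ _ (smooth_preact k i)).
apply: eq_bigr => P _; congr (_ * _); apply: eq_bigr => I _.
by rewrite partialE midx_dirs_block.
Qed.

Lemma alg2_termE k pP : alg2_valid k pP -> forall (P : {set midx_subset alpha}) i,
  alg2_term f y k pP P i 0 =
  mu #|P| (preact f k y i 0) * \prod_(I in P) partial (midx_block I) (z k i) y.
Proof.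
move=> H P i; rewrite !mxE; congr (_ * _); apply: eq_bigr => I _; exact: alg2_pE.
Qed.

Lemma alg2_h_valid k pP : alg2_valid k.+1 pP ->
  forall i, alg2_h f y alpha k.+1 pP i 0 = partial alpha (a k.+1 i) y.
Proof.
move=> H i; rewrite summxE partial_act; apply: eq_bigr => P _; exact: alg2_termE.
Qed.

(** Term by term in the formula of Faa di Bruno, with the product rule for
[dominated]. *)
Lemma alg2_B_valid k pP : alg2_valid k.+1 pP -> forall i x, in_box eps y x ->
  `|partial alpha (a k.+1 i) x - partial alpha (a k.+1 i) y|
    <= alg2_B f N y eps Plow alpha k.+1 pP i 0.
Proof.
move=> H i x xb; rewrite summxE !partial_act.
have D (P : {set midx_subset alpha}) : midx_partition P ->
    dominated (mu #|P| (preact f k.+1 x i 0)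
               * \prod_(I in P) partial (midx_block I) (z k.+1 i) x)
              (mu #|P| (preact f k.+1 y i 0)
               * \prod_(I in P) partial (midx_block I) (z k.+1 i) y)
              (alg2_M f N y eps #|P| k.+1 i 0
               * \prod_(I in P) alg2_phat f y Plow alpha k.+1 pP (midx_block I) i 0).
  move=> PP; apply: dominatedM.
    apply: alg2_M_dominates => //; last exact: alg1_valid_layer.
    (* M_m bounds only derivatives of tanh of order m >= 1: P is not empty *)
    rewrite card_gt0; apply/eqP => P0.
    have := cover_partition PP; rewrite P0 /finset.cover big_set0.
    move=> /(congr1 (fun A : {set _} => #|A|)).
    rewrite cards0 cardsT card_ord size_midx_dirs => a0.
    by have := alpha_ge2; rewrite -a0.
  apply: dominated_prod => I IP; apply: alg2_phat_dominates => //.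
  exact: partition_neq0 PP IP.
apply: le_trans (dominated_sum _ _ _ _ _ _ D) _.
apply/le_of_eq/eq_bigr => P _.
rewrite [RHS]mxE; congr (_ + _); first by rewrite [RHS]mxE; congr (_ * _); rewrite mxE.
by rewrite [RHS]mxE; congr (- _); rewrite [RHS]mxE alg2_termE.
Qed.

Lemma alg2_step_valid k : alg2_valid k.+1 (alg2_step f N y eps Plow alpha k.+1).
Proof.
have alpha_nil : midx_dirs alpha != [::].
  by rewrite -size_eq0 size_midx_dirs -lt0n ltnW.
elim: k => [|k IHk] i.
  rewrite partialE dpart_preact1_ge2 ?size_midx_dirs //.
  by split=> [|x _]; rewrite mxE // subrr normr0.
rewrite partialE dpart_preactS //; split.
  rewrite mxE; apply: eq_bigr => j _; congr (_ * _).
  exact: alg2_h_valid.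
move=> x xb; apply: affine_layer_dist => j; exact: alg2_B_valid.
Qed.

End Step.

(** Induction on the recursion bound s: a step for gamma only calls multi-indices of
degree less than that of gamma, hence at most s - 1. *)
Lemma alg2_layer_valid s gamma k i x : (0 < midx_deg gamma <= s)%N ->
  in_box eps y x ->
  `|partial gamma (z k.+1 i) x - partial gamma (z k.+1 i) y|
    <= alg2_layer f N y eps s gamma k.+1 i 0.
Proof.
elim: s gamma k i x => [|s IHs] gamma k i x /andP[g0 gs] xb.
  by move: g0; rewrite ltnNge gs.
rewrite /=; case: pickP => [l /eqP ->|nu].
  rewrite mxE partialE midx_dirs_unit; exact: (alg1_valid_layer k i l).2.
have g2 : (2 <= midx_deg gamma)%N.
  rewrite ltn_neqAle g0 andbT; apply/negP => /eqP/esym/midx_deg1[l El].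
  by have := nu l; rewrite El eqxx.
apply: (alg2_step_valid _ _ g2 _ k i).2 => // b k' i' x' /andP[b0 bg] xb'.
by apply: IHs => //; rewrite b0 /= -ltnS (leq_trans bg).
Qed.

End Network.

Theorem theorem3p7 (R : realType) (n w L : nat) (hL : (0 < L)%N)
    (N : nat -> nat) (f : network R n w) (y eps : 'cV[R]_n)
    (heps : forall j, 0 <= eps j 0)
    (alpha : multiindex n) (halpha : (2 <= midx_deg alpha)%N) :
  forall x : 'cV[R]_n, in_box eps y x ->
    `|partial alpha (network_fun f L) x - partial alpha (network_fun f L) y|
      <= ALG f N y eps L alpha.
Proof.
move=> x xb; case: L hL => // L _.
rewrite network_funE partialE (smooth_affine _ _ _ _ _).1; last 2 first.
- by move=> j; exact: smooth_act.
- by rewrite -size_eq0 size_midx_dirs -lt0n ltnW.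
rewrite /ALG; set Plow := alg2_layer _ _ _ _ _.
have PlowV gamma k i x' : (0 < midx_deg gamma < midx_deg alpha)%N -> in_box eps y x' ->
  `|partial gamma (fun x => preact f k.+1 x i 0) x' -
    partial gamma (fun x => preact f k.+1 x i 0) y| <= Plow gamma k.+1 i 0.
  move=> /andP[g0 ga] xb'; apply: alg2_layer_valid => //.
  by rewrite g0 -ltnS prednK // (leq_trans _ halpha).
have Sv := alg2_step_valid f N y eps Plow alpha halpha PlowV L.
by apply: affine_layer_dist => j; apply: alg2_B_valid.
Qed.
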